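(* Let $T$ be a polynomially Riesz operator on a complex Banach space $X$. Then for every complete chain $\mathcal C$ of closed subspaces of $X$ that are invariant under $T$, we have $$\sigma(T)=\sigma_e(T)\cup\bigcup\{\sigma(T_{\mathcal M}):\ \mathcal M\in\mathcal C,\ \mathcal M_-\neq\mathcal M\}.$$
   Context: $\mathcal B(X)$ is the Banach algebra of bounded linear operators on $X$, $\mathcal K(X)$ its closed ideal of compact operators, and $\pi\colon\mathcal B(X)\to\mathcal B(X)/\mathcal K(X)$ the canonical projection onto the Calkin algebra. $\sigma(T)$ is the spectrum of $T$ in $\mathcal B(X)$, and $\sigma_e(T):=\sigma(\pi(T))$ is the spectrum of $\pi(T)$ in the Calkin algebra. $T$ is a Riesz operator if $\pi(T)$ is quasinilpotent, i.e. $\lim_n\|\pi(T)^n\|^{1/n}=0$; $T$ is polynomially Riesz if $p(T)$ is a Riesz operator for some non-zero complex polynomial $p$. A chain $\mathcal C$ of closed subspaces of $X$ (totally ordered by inclusion) is complete if it contains arbitrary intersections and closed linear spans of its members (including those of the empty family, so $\{0\},X\in\mathcal C$). For $\mathcal M\in\mathcal C$, the predecessor $\mathcal M_-$ of $\mathcal M$ in $\mathcal C$ is the closed linear span of all proper subspaces of $\mathcal M$ belonging to $\mathcal C$. For $\mathcal M\in\mathcal C$ with $\mathcal M\ne\mathcal M_-$, $T_{\mathcal M}$ is the operator induced by $T$ on the quotient Banach space $\mathcal M/\mathcal M_-$, $T_{\mathcal M}(x+\mathcal M_-)=Tx+\mathcal M_-$. *)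

(* Defs.v *)
From HB Require Import structures.
From mathcomp Require Import all_boot all_order all_algebra generic_quotient.
From mathcomp Require Import all_classical all_reals all_analysis.
From mathcomp Require Import complex.

Set Implicit Arguments.
Unset Strict Implicit.
Unset Printing Implicit Defensive.

Import Order.TTheory GRing.Theory Num.Theory.
Import numFieldNormedType.Exports.

Local Open Scope classical_set_scope.
Local Open Scope ring_scope.
Local Open Scope quotient_scope.
Local Open Scope complex_scope.

(* A unital algebra over K, as a ring with a central image of K.  The library's
   [algType] is not used because it requires 1 != 0, which fails in B(0) and in
   the Calkin algebra of a finite-dimensional space. *)
HB.mixin Record PzRing_isUnitalAlgebra (K : pzRingType) A of GRing.PzRing A := {
  scalar_of : K -> A;
  scalar_of1 : scalar_of 1 = 1;
  scalar_ofD : {morph scalar_of : k l / k + l};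
  scalar_ofM : {morph scalar_of : k l / k * l};
  scalar_ofC : forall (k : K) (a : A), scalar_of k * a = a * scalar_of k
}.

#[short(type="unitalAlgType")]
HB.structure Definition UnitalAlgebra (K : pzRingType) :=
  {A of GRing.PzRing A & PzRing_isUnitalAlgebra K A}.

Section UnitalAlgebraTheory.
Context {K : nzRingType} {A : unitalAlgType K}.

Definition invertible (a : A) : Prop := exists b : A, a * b = 1 /\ b * a = 1.

Definition spectrum (a : A) : set K := [set l | ~ invertible (a - scalar_of l)].

Definition poly_eval (p : {poly K}) (a : A) : A :=
  \sum_(i < size p) scalar_of p`_i * a ^+ i.

End UnitalAlgebraTheory.

Section Subspaces.
Context {K : nzRingType} {V : lmodType K}.

Record linear_subspace := LinearSubspace {
  linear_subspace_set :> V -> Prop;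
  linear_subspace0 : linear_subspace_set 0;
  linear_subspaceP : forall k x y,
    linear_subspace_set x -> linear_subspace_set y -> linear_subspace_set (k *: x + y) }.

Lemma linear_subspaceD (M : linear_subspace) x y : M x -> M y -> M (x + y).
Proof. by move=> Mx My; rewrite -[x]scale1r; apply: linear_subspaceP. Qed.

Lemma linear_subspaceZ (M : linear_subspace) k x : M x -> M (k *: x).
Proof. by move=> Mx; rewrite -[_ *: _]addr0; apply/linear_subspaceP/linear_subspace0. Qed.

Lemma linear_subspaceN (M : linear_subspace) x : M x -> M (- x).
Proof. by move=> Mx; rewrite -scaleN1r; apply: linear_subspaceZ. Qed.

Lemma linear_subspaceB (M : linear_subspace) x y : M x -> M y -> M (x - y).
Proof. by move=> Mx My; apply: linear_subspaceD => //; apply: linear_subspaceN. Qed.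

Definition linear_span (A : set V) : set V :=
  [set x | exists s : seq (K * V),
     (forall p, p \in s -> A p.2) /\ x = \sum_(p <- s) p.1 *: p.2].

Lemma linear_span0 A : linear_span A 0.
Proof. by exists [::]; split => //; rewrite big_nil. Qed.

Lemma linear_spanP A k x y :
  linear_span A x -> linear_span A y -> linear_span A (k *: x + y).
Proof.
move=> [s [sA ->]] [t [tA ->]]; exists ([seq (k * p.1, p.2) | p <- s] ++ t).
split=> [p|].
  by rewrite mem_cat => /orP[/mapP[q qs ->]|/tA//]; exact: (sA q qs).
rewrite big_cat big_map scaler_sumr /=; congr (_ + _).
by apply: eq_bigr => p _; rewrite scalerA.
Qed.

Definition linear_subspace_eqv (N : linear_subspace) : rel V := fun x y => `[< N (x - y) >].

Lemma linear_subspace_eqv_is_equiv (N : linear_subspace) : equiv_class_of (linear_subspace_eqv N).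
Proof.
split=> [x|x y|y x z].
- by apply/asboolP; rewrite subrr; apply: linear_subspace0.
- by apply/idP/idP => /asboolP/linear_subspaceN xy; apply/asboolP; move: xy; rewrite opprB.
- move=> /asboolP xy /asboolP yz; apply/asboolP.
  by rewrite -(subrK y x) -addrA; apply: linear_subspaceD.
Qed.

Canonical linear_subspace_equiv (N : linear_subspace) := EquivRelPack (linear_subspace_eqv_is_equiv N).

End Subspaces.
Arguments linear_subspace {K} V.

Section LinearQuotient.
Context {K : nzRingType} {V : lmodType K} (N : linear_subspace V).

Definition linear_quotient := {eq_quot linear_subspace_eqv N}.
HB.instance Definition _ := EqQuotient.on linear_quotient.
HB.instance Definition _ := Choice.on linear_quotient.

Local Notation Q := linear_quotient.

Lemma quotient_eqP x y : reflect (N (x - y)) (\pi_Q x == \pi_Q y).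
Proof. by rewrite piE; exact: asboolP. Qed.

Lemma quotient_eq x y : \pi_Q x = \pi_Q y <-> N (x - y).
Proof. by split => [/eqP/quotient_eqP|/quotient_eqP/eqP]. Qed.

Lemma repr_quotient x : N (repr (\pi_Q x) - x).
Proof. by apply/quotient_eq; rewrite reprK. Qed.

Lemma quotient_ind (P : Q -> Prop) : (forall x, P (\pi_Q x)) -> forall q, P q.
Proof. by move=> Px q; rewrite -[q]reprK. Qed.

Definition quotient_add (p q : Q) : Q := \pi_Q (repr p + repr q).
Definition quotient_opp (p : Q) : Q := \pi_Q (- repr p).
Definition quotient_scale (k : K) (p : Q) : Q := \pi_Q (k *: repr p).

Let pi_add x y : quotient_add (\pi_Q x) (\pi_Q y) = \pi_Q (x + y).
Proof.
apply/quotient_eq; rewrite opprD addrACA.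
by apply: linear_subspaceD; apply: repr_quotient.
Qed.

Let pi_opp x : quotient_opp (\pi_Q x) = \pi_Q (- x).
Proof. by apply/quotient_eq; rewrite -opprD; apply/linear_subspaceN/repr_quotient. Qed.

Let pi_scale k x : quotient_scale k (\pi_Q x) = \pi_Q (k *: x).
Proof. by apply/quotient_eq; rewrite -scalerBr; apply/linear_subspaceZ/repr_quotient. Qed.

Let addA : associative quotient_add.
Proof.
move=> p q r; elim/quotient_ind: p => x; elim/quotient_ind: q => y; elim/quotient_ind: r => z.
by rewrite !pi_add addrA.
Qed.

Let addC : commutative quotient_add.
Proof.
by move=> p q; elim/quotient_ind: p => x; elim/quotient_ind: q => y; rewrite !pi_add addrC.
Qed.

Let add0 : left_id (\pi_Q 0) quotient_add.
Proof. by move=> p; elim/quotient_ind: p => x; rewrite pi_add add0r. Qed.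

Let addN : left_inverse (\pi_Q 0) quotient_opp quotient_add.
Proof. by move=> p; elim/quotient_ind: p => x; rewrite pi_opp pi_add addNr. Qed.

HB.instance Definition _ := GRing.isZmodule.Build Q addA addC add0 addN.

Let scaleA k l p :
  quotient_scale k (quotient_scale l p) = quotient_scale (k * l) p.
Proof. by elim/quotient_ind: p => x; rewrite !pi_scale scalerA. Qed.

Let scale1 : left_id 1 quotient_scale.
Proof. by move=> p; elim/quotient_ind: p => x; rewrite pi_scale scale1r. Qed.

Let scaleDr : right_distributive quotient_scale +%R.
Proof.
move=> k p q; elim/quotient_ind: p => x; elim/quotient_ind: q => y.
by rewrite [_ + _]pi_add !pi_scale [RHS]pi_add scalerDr.
Qed.

Let scaleDl p : {morph quotient_scale^~ p : k l / k + l}.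
Proof.
by move=> k l; elim/quotient_ind: p => x; rewrite !pi_scale [RHS]pi_add scalerDl.
Qed.

HB.instance Definition _ :=
  GRing.Zmodule_isLmodule.Build K Q scaleA scale1 scaleDr scaleDl.

Lemma quotient_piD x y : \pi_Q (x + y) = \pi_Q x + \pi_Q y.
Proof. by rewrite -pi_add. Qed.

Lemma quotient_piZ k x : \pi_Q (k *: x) = k *: \pi_Q x.
Proof. by rewrite -pi_scale. Qed.

Lemma quotient_piN x : \pi_Q (- x) = - \pi_Q x.
Proof. by rewrite -scaleN1r quotient_piZ scaleN1r. Qed.

Lemma quotient_piB x y : \pi_Q (x - y) = \pi_Q x - \pi_Q y.
Proof. by rewrite quotient_piD quotient_piN. Qed.

End LinearQuotient.

Section ClosedSubspaces.
Context {K : numFieldType} {V : normedModType K}.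

Record closed_subspace := ClosedSubspace {
  closed_subspace_subspace :> linear_subspace V;
  closed_subspace_closed : closed (closed_subspace_subspace : set V) }.

Lemma closed_subspace_eq (M N : closed_subspace) :
  (M : set V) = (N : set V) -> M = N.
Proof.
case: M N => -[M M0 MP] Mc [[N N0 NP] Nc] /= MN.
move: M0 MP Mc N0 NP Nc; rewrite MN => M0 MP Mc N0 NP Nc.
by rewrite (Prop_irrelevance M0 N0) (Prop_irrelevance MP NP)
           (Prop_irrelevance Mc Nc).
Qed.

(* For the empty family this is the whole space. *)
Definition closed_subspace_bigcap (F : set closed_subspace) : closed_subspace.
Proof.
exists (@LinearSubspace _ V (\bigcap_(M in F) (M : set V))
  (fun M _ => linear_subspace0 M)
  (fun k x y Fx Fy M FM => linear_subspaceP k (Fx M FM) (Fy M FM))).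
by apply: closed_bigI => M _; exact: closed_subspace_closed.
Defined.

Lemma closure_linear_span0 (A : set V) : closure (linear_span A) 0.
Proof. exact/subset_closure/linear_span0. Qed.

Lemma closure_linear_spanP (A : set V) k x y :
  closure (linear_span A) x -> closure (linear_span A) y ->
  closure (linear_span A) (k *: x + y).
Proof.
move=> clx cly U Uxy.
have cf : (fun z : V * V => k *: z.1 + z.2) @ (x, y) --> k *: x + y.
  apply: (@cvgD _ _ _ _ _ (fun z : V * V => k *: z.1) snd).
    by apply: cvgZr; exact: cvg_fst.
  exact: cvg_snd.
have [[/= P Q] [Px Qy] PQ] := cf _ Uxy.
have [x' [Ax' Px']] := clx _ Px; have [y' [Ay' Qy']] := cly _ Qy.
exists (k *: x' + y'); split; first exact: linear_spanP.
exact: (PQ (x', y')).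
Qed.

Definition closed_span (A : set V) : closed_subspace :=
  @ClosedSubspace
    (LinearSubspace (closure_linear_span0 A) (@closure_linear_spanP A))
    (@closed_closure V (linear_span A)).

Definition closed_subspace_span (F : set closed_subspace) : closed_subspace :=
  closed_span (\bigcup_(M in F) (M : set V)).

End ClosedSubspaces.
Arguments closed_subspace {K} V.

Section SubspaceType.
Context {K : numFieldType} {V : normedModType K} (M : closed_subspace V).

Definition subspace_pred : {pred V} := fun x => x \in (M : set V).

Record subspace_type := SubspaceType {
  subspace_val :> V;
  _ : subspace_val \in subspace_pred }.

HB.instance Definition _ := [isSub for subspace_val].
HB.instance Definition _ := [Choice of subspace_type by <:].

Let closedS : GRing.subsemimod_closed subspace_pred.
Proof.
split; first split.
- exact/mem_set/linear_subspace0.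
- by move=> x y /set_mem Mx /set_mem My; apply/mem_set/linear_subspaceD.
- by move=> k x /set_mem Mx; apply/mem_set/linear_subspaceZ.
Qed.

HB.instance Definition _ :=
  GRing.SubChoice_isSubLmodule.Build K V subspace_pred subspace_type closedS.

Let norm (x : subspace_type) : K := `|\val x|.

Let norm_triangle x y : norm (x + y) <= norm x + norm y.
Proof. by rewrite /norm raddfD ler_normD. Qed.

Let normZ (k : K) x : norm (k *: x) = `|k| * norm x.
Proof. by rewrite /norm linearZ normrZ. Qed.

Let norm0 x : norm x = 0 -> x = 0.
Proof. by move/normr0_eq0 => x0; apply: val_inj; rewrite x0 raddf0. Qed.

HB.instance Definition _ :=
  Lmodule_isNormed.Build K subspace_type norm_triangle normZ norm0.

Lemma norm_subspaceE (x : subspace_type) : `|x| = `|\val x|.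
Proof. by []. Qed.

End SubspaceType.

Section NormedQuotient.
Context {R : realType} {V : normedModType R[i]}.

(* `|x| is a non-negative element of [R[i]]. *)
Definition real_norm (x : V) : R := complex.Re `|x|.

Lemma real_normE x : `|x| = (real_norm x)%:C.
Proof. by rewrite /real_norm RRe_real ?normr_real. Qed.

Lemma real_norm_ge0 x : 0 <= real_norm x.
Proof. by rewrite -lecR -real_normE; exact: normr_ge0. Qed.

Lemma real_normD x y : real_norm (x + y) <= real_norm x + real_norm y.
Proof. by rewrite -lecR rmorphD/= -!real_normE ler_normD. Qed.

Lemma real_normZ (k : R[i]) x :
  real_norm (k *: x) = complex.Re `|k| * real_norm x.
Proof.
apply: (@complexI R); rewrite rmorphM /= -(real_normE x) -real_normE.
by rewrite normrZ.
Qed.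

Section Norm.
Variable N : linear_subspace V.
Local Notation Q := (linear_quotient N).
Implicit Types p q : Q.

Definition quotient_real_norm q : R :=
  inf [set real_norm x | x in [set x | \pi_Q x = q]].

Let reps q := [set real_norm x | x in [set x | \pi_Q x = q]].

Let has_inf_reps q : has_inf (reps q).
Proof.
split; last by exists 0 => _ [x _ <-]; exact: real_norm_ge0.
by exists (real_norm (repr q)), (repr q) => //=; rewrite reprK.
Qed.

Lemma quotient_real_norm_le x : quotient_real_norm (\pi_Q x) <= real_norm x.
Proof. by apply: ge_inf; [case: (has_inf_reps (\pi_Q x))|exists x]. Qed.

Lemma quotient_real_norm_adherent q (e : R) : 0 < e ->
  exists2 x, \pi_Q x = q & real_norm x < quotient_real_norm q + e.
Proof.
move=> e0; have [_ [x xq <-] xe] := inf_adherent e0 (has_inf_reps q).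
by exists x.
Qed.

Lemma quotient_real_norm_ge q (c : R) :
  (forall x, \pi_Q x = q -> c <= real_norm x) -> c <= quotient_real_norm q.
Proof.
move=> cq; apply: lb_le_inf; first by case: (has_inf_reps q).
by move=> _ [x xq <-]; exact: cq.
Qed.

Lemma quotient_real_norm_ge0 q : 0 <= quotient_real_norm q.
Proof. by apply: quotient_real_norm_ge => x _; exact: real_norm_ge0. Qed.

Lemma quotient_real_normD p q :
  quotient_real_norm (p + q) <= quotient_real_norm p + quotient_real_norm q.
Proof.
apply/ler_addgt0Pr => e e0; have e20 : 0 < e / 2 by rewrite divr_gt0.
have [x xp xe] := quotient_real_norm_adherent p e20.
have [y yq ye] := quotient_real_norm_adherent q e20.
rewrite -xp -yq -quotient_piD (le_trans (quotient_real_norm_le _))//.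
rewrite (le_trans (real_normD _ _))// xp yq (splitr e) addrACA.
by apply: lerD; exact: ltW.
Qed.

Let normZ_le (k : R[i]) q :
  quotient_real_norm (k *: q) <= complex.Re `|k| * quotient_real_norm q.
Proof.
have k0 : 0 <= complex.Re `|k|.
  by rewrite -lecR RRe_real ?normr_real//; exact: normr_ge0.
have := k0; rewrite le_eqVlt => /predU1P[k00|kgt0].
  rewrite -k00 mul0r; have -> : k = 0.
    apply/eqP; rewrite -normr_eq0 -[`|k|]RRe_real ?normr_real//.
    by rewrite -k00.
  rewrite scale0r -[0 : Q](scale0r (\pi_Q 0)) -quotient_piZ.
  by rewrite (le_trans (quotient_real_norm_le _))// real_normZ normr0 mul0r.
rewrite -ler_pdivrMl//; apply: quotient_real_norm_ge => x <-.
rewrite ler_pdivrMl// -real_normZ -quotient_piZ.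
exact: quotient_real_norm_le.
Qed.

Lemma quotient_real_normZ (k : R[i]) q :
  quotient_real_norm (k *: q) = complex.Re `|k| * quotient_real_norm q.
Proof.
apply/eqP; rewrite eq_le normZ_le andTb.
have [->|k0] := eqVneq k 0.
  by rewrite normr0 mul0r quotient_real_norm_ge0.
have kgt0 : 0 < complex.Re `|k|.
  by rewrite -ltcR RRe_real ?normr_real//; rewrite -normr_gt0 in k0.
rewrite -ler_pdivlMl// -{1}(scale1r q) -(mulVf k0) -scalerA.
rewrite (le_trans (normZ_le _ _))//.
suff -> : complex.Re `|k^-1| = (complex.Re `|k|)^-1 by [].
by apply: (@complexI R); rewrite fmorphV; exact: normfV.
Qed.

End Norm.

Variable N : closed_subspace V.

Definition normed_quotient := linear_quotient N.
HB.instance Definition _ := EqQuotient.on normed_quotient.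
HB.instance Definition _ := GRing.Lmodule.on normed_quotient.

Local Notation Q := normed_quotient.

Let norm (q : Q) : R[i] := (quotient_real_norm q)%:C.

Let norm_triangle p q : norm (p + q) <= norm p + norm q.
Proof. by rewrite /norm -rmorphD lecR quotient_real_normD. Qed.

Let normZ (k : R[i]) q : norm (k *: q) = `|k| * norm q.
Proof.
by rewrite /norm quotient_real_normZ rmorphM.
Qed.

Let norm0 q : norm q = 0 -> q = 0.
Proof.
move=> /complexI q0; rewrite -[q]reprK.
rewrite -[RHS](scale0r (\pi_(linear_quotient N) 0)) -quotient_piZ scale0r.
apply/quotient_eq; rewrite subr0; apply: (@closed_subspace_closed _ _ N).
move=> U /nbhs_ballP[e /= e0 eU].
have e0' : 0 < complex.Re e by rewrite -ltcR RRe_real// gtr0_real.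
have [x xq xe] := quotient_real_norm_adherent q e0'.
exists (repr q - x); split.
  by apply/(@quotient_eq _ _ N); rewrite reprK.
apply: eU; rewrite -ball_normE /= opprB addrC subrK.
rewrite real_normE -(RRe_real (gtr0_real e0)) ltcR.
by rewrite q0 add0r in xe.
Qed.

HB.instance Definition _ :=
  Lmodule_isNormed.Build R[i] normed_quotient norm_triangle normZ norm0.

Lemma norm_quotientE (q : normed_quotient) :
  `|q| = (quotient_real_norm q)%:C.
Proof. by []. Qed.

End NormedQuotient.
Arguments normed_quotient {R V} N.

Section BoundedOperators.
Context {K : numFieldType} (X : normedModType K).

Definition bounded_linear (f : X -> X) : Prop :=
  linear f /\ exists M : K, forall x, `|f x| <= M * `|x|.

Definition bounded_linear_pred : {pred X -> X} := fun f => `[< bounded_linear f >].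

Record bounded_operator := BoundedOperator {
  operator_fun :> X -> X;
  _ : operator_fun \in bounded_linear_pred }.

HB.instance Definition _ := [isSub for operator_fun].
HB.instance Definition _ := [Choice of bounded_operator by <:].

Lemma bounded_operatorP (T : bounded_operator) : bounded_linear T.
Proof. by case: T => f /= /asboolP. Qed.

Lemma operator_linear (T : bounded_operator) : linear T.
Proof. by case: (bounded_operatorP T). Qed.

HB.instance Definition _ (T : bounded_operator) :=
  GRing.isLinear.Build K X X _ (operator_fun T) (operator_linear T).

Lemma operator_eq (S T : bounded_operator) : (forall x, S x = T x) -> S = T.
Proof. by move=> ST; apply/val_inj/funext. Qed.

Lemma operator_bound (T : bounded_operator) :
  exists2 M : K, 0 < M & forall x, `|T x| <= M * `|x|.
Proof.
have [_ [M TM]] := bounded_operatorP T.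
exists (`|M| + 1) => [|x]; first by rewrite ltr_wpDl.
rewrite (le_trans (TM x))// mulrDl mul1r.
have M0 : 0 <= M * `|x| by rewrite (le_trans _ (TM x)).
by rewrite -[leLHS]ger0_norm// normrM normr_id lerDl.
Qed.

Lemma operator_continuous (T : bounded_operator) : continuous T.
Proof.
have [M M0 TM] := operator_bound T.
apply: bounded_linear_continuous; apply/bounded_funP => r.
exists (M * r) => x xr; rewrite (le_trans (TM x))//.
by rewrite ler_wpM2l// ltW.
Qed.

Let closedB : GRing.subsemimod_closed bounded_linear_pred.
Proof.
split; first split.
- apply/asboolP; split=> [k x y|]; first by rewrite /= scaler0 addr0.
  by exists 0 => x; rewrite normr0 mul0r.
- move=> f g /asboolP[fl [M fM]] /asboolP[gl [L gL]]; apply/asboolP; split.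
    move=> k x y; rewrite !fctE fl gl scalerDr -!addrA; congr (_ + _).
    by rewrite addrCA.
  exists (M + L) => x; rewrite mulrDl (le_trans (ler_normD _ _))//.
  exact: lerD.
- move=> k f /asboolP[fl [M fM]]; apply/asboolP; split.
    by move=> l x y; rewrite !fctE fl scalerDr !scalerA mulrC.
  exists (`|k| * M) => x; rewrite !fctE normrZ -mulrA.
  by rewrite ler_wpM2l.
Qed.

HB.instance Definition _ := GRing.SubChoice_isSubLmodule.Build K (X -> X)
  bounded_linear_pred bounded_operator closedB.

Let id_bounded : id \in bounded_linear_pred.
Proof. by apply/asboolP; split => //; exists 1 => x; rewrite mul1r. Qed.

Let comp_bounded (S T : bounded_operator) : S \o T \in bounded_linear_pred.
Proof.
apply/asboolP; split; first by move=> k x y; rewrite /= !linearP.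
have [M M0 SM] := operator_bound S; have [L L0 TL] := operator_bound T.
exists (M * L) => x; rewrite (le_trans (SM _))// -mulrA.
by rewrite ler_wpM2l// ltW.
Qed.

Definition operator_id : bounded_operator := BoundedOperator id_bounded.
Definition operator_comp (S T : bounded_operator) : bounded_operator :=
  BoundedOperator (comp_bounded S T).

Let compA : associative operator_comp.
Proof. by move=> S T U; apply: operator_eq. Qed.
Let comp1l : left_id operator_id operator_comp.
Proof. by move=> S; apply: operator_eq. Qed.
Let comp1r : right_id operator_id operator_comp.
Proof. by move=> S; apply: operator_eq. Qed.
Let compDl : left_distributive operator_comp +%R.
Proof. by move=> S T U; apply: operator_eq. Qed.
Let compDr : right_distributive operator_comp +%R.
Proof. by move=> S T U; apply: operator_eq => x; exact: raddfD. Qed.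

HB.instance Definition _ := GRing.Zmodule_isPzRing.Build bounded_operator
  compA comp1l comp1r compDl compDr.

Lemma operator_mulE (S T : bounded_operator) x : (S * T) x = S (T x).
Proof. by []. Qed.

Lemma operator_scaleAl (k : K) (S T : bounded_operator) :
  k *: (S * T) = (k *: S) * T.
Proof. exact: operator_eq. Qed.

Lemma operator_scaleAr (k : K) (S T : bounded_operator) :
  k *: (S * T) = S * (k *: T).
Proof. by apply: operator_eq => x; rewrite [RHS]linearZ. Qed.

Definition operator_scalar (k : K) : bounded_operator := k *: (1 : bounded_operator).

Let scalar1 : operator_scalar 1 = 1. Proof. exact: scale1r. Qed.
Let scalarD : {morph operator_scalar : k l / k + l}.
Proof. by move=> k l; exact: scalerDl. Qed.
Let scalarM : {morph operator_scalar : k l / k * l}.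
Proof.
by move=> k l; rewrite /operator_scalar -operator_scaleAl mul1r scalerA.
Qed.
Let scalarC (k : K) (T : bounded_operator) :
  operator_scalar k * T = T * operator_scalar k.
Proof. by rewrite -operator_scaleAl -operator_scaleAr mul1r mulr1. Qed.

HB.instance Definition _ := PzRing_isUnitalAlgebra.Build K bounded_operator
  scalar1 scalarD scalarM scalarC.

Definition compact_operator (T : bounded_operator) : Prop :=
  forall A : set X, bounded_set A -> precompact (T @` A).

Lemma compact_operator0 : compact_operator 0.
Proof.
move=> A _; apply: (@precompact_subset _ _ [set 0]); first by move=> _ [x _ <-].
by apply: compact_precompact; [exact: norm_hausdorff|exact: compact_set1].
Qed.

Lemma compact_operatorP k (S T : bounded_operator) :
  compact_operator S -> compact_operator T -> compact_operator (k *: S + T).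
Proof.
move=> cS cT A bA; pose f (z : X * X) := k *: z.1 + z.2.
have cf : continuous f.
  move=> z; apply: (@cvgD _ _ _ _ _ (fun z : X * X => k *: z.1) snd).
    by apply: cvgZr; exact: cvg_fst.
  exact: cvg_snd.
have /compact_precompact : compact
    (f @` (closure (S @` A) `*` closure (T @` A))).
  apply: continuous_compact; first exact: continuous_subspaceT.
  by apply: compact_setX; rewrite -precompactE; [exact: cS|exact: cT].
move=> /(_ (@norm_hausdorff _ _)); apply: precompact_subset.
move=> _ [x Ax <-]; exists (S x, T x) => //.
by split; apply: subset_closure; exists x.
Qed.

Definition compact_operators : linear_subspace bounded_operator :=
  LinearSubspace compact_operator0 compact_operatorP.

Lemma compact_operator_mulr (S T : bounded_operator) :
  compact_operator T -> compact_operator (S * T).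
Proof.
move=> cT A bA.
have /compact_precompact : compact (S @` closure (T @` A)).
  apply: continuous_compact; first exact/continuous_subspaceT/operator_continuous.
  by rewrite -precompactE; exact: cT.
move=> /(_ (@norm_hausdorff _ _)); apply: precompact_subset.
by move=> _ [x Ax <-]; exists (T x) => //; apply: subset_closure; exists x.
Qed.

Lemma compact_operator_mull (S T : bounded_operator) :
  compact_operator S -> compact_operator (S * T).
Proof.
move=> cS A bA.
have -> : (S * T) @` A = S @` (T @` A).
  by rewrite image_comp.
apply: cS; have [M M0 TM] := operator_bound T.
have [L [Lr AL]] := bA; exists (M * (L + 1)); split.
  by rewrite realM ?realD ?(gtr0_real M0) ?real1.
move=> r Mr _ [x Ax <-] /=; rewrite (le_trans (TM x))// (le_trans _ (ltW Mr))//.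
by rewrite ler_wpM2l// ?(ltW M0)//; apply: AL => //; rewrite ltrDl.
Qed.

Definition calkin := linear_quotient compact_operators.
HB.instance Definition _ := EqQuotient.on calkin.
HB.instance Definition _ := GRing.Lmodule.on calkin.

Implicit Types (a b c : calkin) (S T : bounded_operator).

Definition calkin_proj T : calkin := \pi_calkin T.

Definition calkin_mul a b : calkin := calkin_proj (repr a * repr b).

Lemma calkin_proj_mul S T :
  calkin_mul (calkin_proj S) (calkin_proj T) = calkin_proj (S * T).
Proof.
apply/(@quotient_eq _ _ compact_operators).
set S' := repr _; set T' := repr _.
have -> : S' * T' - S * T = (S' - S) * T' + S * (T' - T).
  by rewrite mulrBl mulrBr addrA subrK.
apply: (@linear_subspaceD _ _ compact_operators).
  by apply: compact_operator_mull; exact: (@repr_quotient _ _ compact_operators).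
by apply: compact_operator_mulr; exact: (@repr_quotient _ _ compact_operators).
Qed.

Lemma calkin_projD S T : calkin_proj (S + T) = calkin_proj S + calkin_proj T.
Proof. exact: quotient_piD. Qed.

Lemma calkin_projZ k T : calkin_proj (k *: T) = k *: calkin_proj T.
Proof. exact: quotient_piZ. Qed.

Lemma calkin_ind (P : calkin -> Prop) :
  (forall T, P (calkin_proj T)) -> forall a, P a.
Proof. exact: quotient_ind. Qed.

Let calkin_mulA : associative calkin_mul.
Proof.
move=> a b c; elim/calkin_ind: a => S; elim/calkin_ind: b => T.
by elim/calkin_ind: c => U; rewrite !calkin_proj_mul mulrA.
Qed.
Let calkin_mul1l : left_id (calkin_proj 1) calkin_mul.
Proof. by move=> a; elim/calkin_ind: a => T; rewrite calkin_proj_mul mul1r. Qed.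
Let calkin_mul1r : right_id (calkin_proj 1) calkin_mul.
Proof. by move=> a; elim/calkin_ind: a => T; rewrite calkin_proj_mul mulr1. Qed.
Let calkin_mulDl : left_distributive calkin_mul +%R.
Proof.
move=> a b c; elim/calkin_ind: a => S; elim/calkin_ind: b => T.
elim/calkin_ind: c => U.
by rewrite -calkin_projD !calkin_proj_mul -calkin_projD mulrDl.
Qed.
Let calkin_mulDr : right_distributive calkin_mul +%R.
Proof.
move=> a b c; elim/calkin_ind: a => S; elim/calkin_ind: b => T.
elim/calkin_ind: c => U.
by rewrite -calkin_projD !calkin_proj_mul -calkin_projD mulrDr.
Qed.

HB.instance Definition _ := GRing.Zmodule_isPzRing.Build calkin
  calkin_mulA calkin_mul1l calkin_mul1r calkin_mulDl calkin_mulDr.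

Lemma calkin_projM S T : calkin_proj (S * T) = calkin_proj S * calkin_proj T.
Proof. by rewrite -calkin_proj_mul. Qed.

Definition calkin_scalar (k : K) : calkin := k *: (1 : calkin).

Let calkin_scalarE k : calkin_scalar k = calkin_proj (scalar_of k).
Proof. by rewrite [RHS]calkin_projZ. Qed.
Let calkin_scalar1 : calkin_scalar 1 = 1. Proof. exact: scale1r. Qed.
Let calkin_scalarD : {morph calkin_scalar : k l / k + l}.
Proof. by move=> k l; exact: scalerDl. Qed.
Let calkin_scalarM : {morph calkin_scalar : k l / k * l}.
Proof. by move=> k l; rewrite !calkin_scalarE scalar_ofM calkin_projM. Qed.
Let calkin_scalarC k a : calkin_scalar k * a = a * calkin_scalar k.
Proof.
elim/calkin_ind: a => T.
by rewrite calkin_scalarE -!calkin_projM scalar_ofC.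
Qed.

HB.instance Definition _ := PzRing_isUnitalAlgebra.Build K calkin
  calkin_scalar1 calkin_scalarD calkin_scalarM calkin_scalarC.

Definition essential_spectrum T : set K := spectrum (calkin_proj T).

End BoundedOperators.
Arguments bounded_operator {K} X.
Arguments calkin {K} X.

Section Riesz.
Context {R : realType} {X : normedModType R[i]}.

Definition operator_norm (T : bounded_operator X) : R :=
  sup [set real_norm (T x) | x in [set x | `|x| <= 1]].

(* The quotient norm, i.e. the distance of a representative to the compact
   operators. *)
Definition calkin_norm (a : calkin X) : R :=
  inf [set operator_norm T | T in [set T | calkin_proj T = a]].

Definition calkin_quasinilpotent (a : calkin X) : Prop :=
  calkin_norm (a ^+ n) `^ n%:R^-1 @[n --> \oo] --> (0 : R).

Definition riesz (T : bounded_operator X) : Prop :=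
  calkin_quasinilpotent (calkin_proj T).

Definition polynomially_riesz (T : bounded_operator X) : Prop :=
  exists p : {poly R[i]}, p != 0 /\ riesz (poly_eval p T).

End Riesz.

Section Chains.
Context {K : numFieldType} {X : normedModType K}.
Implicit Types (C : set (closed_subspace X)) (M N : closed_subspace X).

Definition invariant_subspace (T : bounded_operator X) M : Prop :=
  forall x, M x -> M (T x).

Record complete_chain C : Prop := CompleteChain {
  complete_chain_total : forall M N, C M -> C N ->
    (M : set X) `<=` N \/ (N : set X) `<=` M;
  (* F may be empty, so the whole space and 0 belong to C. *)
  complete_chain_bigcap : forall F, F `<=` C -> C (closed_subspace_bigcap F);
  complete_chain_span : forall F, F `<=` C -> C (closed_subspace_span F) }.

Definition predecessor C M : closed_subspace X :=
  closed_subspace_span [set N | C N /\ (N : set X) `<` M].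

Lemma predecessor_mem C M : complete_chain C -> C (predecessor C M).
Proof. by move=> hC; apply: complete_chain_span => // N []. Qed.

End Chains.

Section Subquotient.
Context {K : numFieldType} {X : normedModType K} (M N : closed_subspace X).

Let trace_set (x : subspace_type M) : Prop := N (val x).

Let trace_set0 : trace_set 0.
Proof. exact: linear_subspace0. Qed.

Let trace_setP k (x y : subspace_type M) :
  trace_set x -> trace_set y -> trace_set (k *: x + y).
Proof. by move=> Nx Ny; apply: (linear_subspaceP k Nx Ny). Qed.

Lemma subspace_val_continuous : continuous (@subspace_val _ _ M).
Proof.
move=> x; apply/(@cvgrPdist_lt _ _ _ (nbhs x)) => e e0.
by apply/nbhs_ballP; exists e => // y; rewrite -ball_normE.
Qed.

Let trace_set_closed : closed (trace_set : set (subspace_type M)).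
Proof.
apply: (@closed_comp _ _ (@subspace_val _ _ M)).
  by move=> x _; exact: subspace_val_continuous.
exact: closed_subspace_closed.
Qed.

Definition trace_subspace : closed_subspace (subspace_type M) :=
  @ClosedSubspace _ _ (LinearSubspace trace_set0 trace_setP) trace_set_closed.

End Subquotient.

(* M / N; in general M / (M `&` N), as N is not required to be a subset of M. *)
Section SubquotientType.
Context {R : realType} {X : normedModType R[i]} (M N : closed_subspace X).

Definition subquotient := normed_quotient (trace_subspace M N).
HB.instance Definition _ := EqQuotient.on subquotient.
HB.instance Definition _ := NormedModule.on subquotient.

Definition subquotient_proj (x : subspace_type M) : subquotient :=
  \pi_subquotient x.

Lemma subquotient_projK (q : subquotient) : subquotient_proj (repr q) = q.
Proof. exact: reprK. Qed.

Lemma subquotient_proj_linear : linear subquotient_proj.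
Proof.
move=> k x y; rewrite /subquotient_proj.
by rewrite [LHS]quotient_piD [X in X + _]quotient_piZ.
Qed.

End SubquotientType.

Section InducedOperator.
Context {R : realType} {X : normedModType R[i]}.
Variables (T : bounded_operator X) (M N : closed_subspace X).
Hypotheses (TM : invariant_subspace T M) (TN : invariant_subspace T N).

Definition restriction (x : subspace_type M) : subspace_type M :=
  SubspaceType (mem_set (TM (set_mem (valP x))) : _ \in subspace_pred M).

Definition induced_fun (q : subquotient M N) : subquotient M N :=
  subquotient_proj N (restriction (repr q)).

Lemma induced_funE x : induced_fun (subquotient_proj N x) = subquotient_proj N (restriction x).
Proof.
apply/(@quotient_eq _ _ (trace_subspace M N)).
have /TN := @repr_quotient _ _ (trace_subspace M N) x.
by rewrite /= linearB.
Qed.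

Let restriction_linear : linear restriction.
Proof. by move=> k x y; apply: val_inj; rewrite /= linearP. Qed.

Let induced_bounded : induced_fun \in @bounded_linear_pred _ (subquotient M N).
Proof.
apply/asboolP; split.
  move=> k p q; rewrite -[p]subquotient_projK -[q]subquotient_projK.
  rewrite -subquotient_proj_linear !induced_funE restriction_linear.
  exact: subquotient_proj_linear.
have [L L0 TL] := operator_bound T; exists L => q.
have L0' : 0 < complex.Re L by rewrite -ltcR RRe_real// gtr0_real.
rewrite -(RRe_real (gtr0_real L0)) !norm_quotientE -rmorphM lecR.
rewrite -ler_pdivrMl//; apply: quotient_real_norm_ge => x <-.
rewrite ler_pdivrMl// induced_funE.
rewrite (le_trans (quotient_real_norm_le _ _))//.
have := TL (val x).
by rewrite -(RRe_real (gtr0_real L0)) !real_normE -rmorphM lecR.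
Qed.

Definition induced_operator : bounded_operator (subquotient M N) :=
  BoundedOperator induced_bounded.

Lemma induced_operatorE x :
  induced_operator (subquotient_proj N x) = subquotient_proj N (restriction x).
Proof. exact: induced_funE. Qed.

End InducedOperator.

Definition chain_operator {R : realType} {X : normedModType R[i]}
    (T : bounded_operator X) (C : set (closed_subspace X))
    (hC : complete_chain C) (hT : forall M, C M -> invariant_subspace T M)
    (M : closed_subspace X) (CM : C M) :
    bounded_operator (subquotient M (predecessor C M)) :=
  induced_operator (hT M CM) (hT _ (predecessor_mem M hC)).

(* Main.v *)
Require Import Defs.
From mathcomp Require Import all_boot all_order all_algebra generic_quotient.
From mathcomp Require Import all_classical all_reals all_analysis.
From mathcomp Require Import complex lra.

Set Implicit Arguments.
Unset Strict Implicit.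
Unset Printing Implicit Defensive.

Import Order.TTheory GRing.Theory Num.Theory.
Import numFieldNormedType.Exports.

Local Open Scope classical_set_scope.
Local Open Scope ring_scope.
Local Open Scope complex_scope.

(** The whole theorem rests on one fact ([fredholm_alternative]): if
    [l] lies outside the essential spectrum and [S = T - l], then on every
    closed [T]-invariant subspace [N] the operator [S] is injective if and only
    if it maps [N] onto [N].

    Granting it, one inclusion is immediate.  If [S] is invertible, then [l] is
    not in the essential spectrum, and [S], being injective on each member [N]
    of the chain, maps [N] onto [N]; hence its inverse leaves [N] invariant
    and induces an inverse of [S] on every [M / M_-].

    For the other inclusion (Ringrose's argument), let [l] be outside the
    essential spectrum and [S] not invertible.  The alternative on [X] shows
    that the kernel of [S] is not zero, and its unit sphere is compact.  By
    compactness there is a least member [M] of the chain that meets the kernel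
    nontrivially ([least_subspace_meeting_kernel]).  Each member [N] strictly
    below [M] satisfies [S N = N] by the alternative, and [S M] is closed, so
    [S M] contains [M_-].  If [M_-] were [M], then [S] would be onto on [M],
    hence injective there, contrary to the choice of [M].  So [M_- <> M], and a
    kernel vector in [M] lies outside [M_-]; its class in [M / M_-] is a
    nonzero vector killed by the induced operator.

    The alternative itself comes from a factorisation ([essential_resolvent]).
    Write the polynomial of the Riesz hypothesis as [q * ('X - l)^m] with
    [q.[l] = c <> 0].  As [S] is invertible modulo the compact operators,
    [q(T)] is still a Riesz operator, so for some [n] the operator
    [W = (q(T) / c)^n] is a compact operator plus one of norm at most [1/8].
    The polynomial [1 - (q / c)^n] vanishes at [l], whence [1 - W = G S] with
    [G] a polynomial in [T].  If the alternative failed on [N], the powers of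
    [S] would give a strictly decreasing sequence of ranges or a strictly
    increasing sequence of kernels, and Riesz's lemma would provide unit
    vectors whose images under [W] are at mutual distance at least [1/2]; this
    contradicts the form of [W] ([no_gap_sequence]).  This works on [N] because [G] and
    [W], being polynomials in [T], preserve [N], while the two parts of [W] are
    only compared with it as operators on [X]. *)

(** * Evaluation of polynomials in a unital algebra *)

Section PolyEval.
Context {K : nzRingType} {A : unitalAlgType K}.
Implicit Types (p q : {poly K}) (a : A) (c : K).

Lemma scalar_of0 : scalar_of 0 = 0 :> A.
Proof. by apply: (addrI (scalar_of 0)); rewrite -scalar_ofD !addr0. Qed.

Lemma poly_eval_widen n p a : (size p <= n)%N ->
  poly_eval p a = \sum_(i < n) scalar_of p`_i * a ^+ i.
Proof.
move=> pn; rewrite /poly_eval (big_ord_widen n (fun i => scalar_of p`_i * a ^+ i) pn).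
rewrite big_mkcond; apply: eq_bigr => i _; case: ltnP => // /(nth_default 0) ->.
by rewrite scalar_of0 mul0r.
Qed.

Lemma poly_evalC c a : poly_eval c%:P a = scalar_of c.
Proof.
rewrite (@poly_eval_widen 1) ?size_polyC_leq1//.
by rewrite big_ord1 coefC eqxx expr0 mulr1.
Qed.

Lemma poly_evalD p q a : poly_eval (p + q) a = poly_eval p a + poly_eval q a.
Proof.
pose n := maxn (size p) (size q).
rewrite (@poly_eval_widen n) ?size_polyD// (@poly_eval_widen n p) ?leq_maxl//.
rewrite (@poly_eval_widen n q) ?leq_maxr// -big_split/=.
by apply: eq_bigr => i _; rewrite coefD scalar_ofD mulrDl.
Qed.

Lemma poly_evalMX p a : poly_eval (p * 'X) a = poly_eval p a * a.
Proof.
rewrite (@poly_eval_widen (size p).+1); last first.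
  by rewrite (leq_trans (size_polyMleq _ _))// size_polyX addn2.
rewrite big_ord_recl coefMX eqxx scalar_of0 mul0r add0r /poly_eval mulr_suml.
by apply: eq_bigr => i _; rewrite coefMX/= -mulrA exprSr.
Qed.

Lemma poly_evalMC p c a : poly_eval (p * c%:P) a = poly_eval p a * scalar_of c.
Proof.
rewrite (@poly_eval_widen (size p)); last first.
  rewrite (leq_trans (size_polyMleq _ _))// size_polyC.
  by case: (c != 0); rewrite /= ?addn1// addn0 leq_pred.
rewrite /poly_eval mulr_suml; apply: eq_bigr => i _.
by rewrite coefMC scalar_ofM -!mulrA -[in RHS]scalar_ofC.
Qed.

Lemma poly_evalM p q a : poly_eval (p * q) a = poly_eval p a * poly_eval q a.
Proof.
elim/poly_ind: q => [|q c IHq]; first by rewrite mulr0 -polyC0 poly_evalC scalar_of0 mulr0.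
by rewrite mulrDr mulrA !poly_evalD !poly_evalMX poly_evalC poly_evalMC IHq mulrDr mulrA.
Qed.

Lemma poly_evalX a : poly_eval 'X a = a.
Proof. by rewrite -[X in poly_eval X]mul1r poly_evalMX -polyC1 poly_evalC scalar_of1 mul1r. Qed.

Lemma poly_eval_XsubC c a : poly_eval ('X - c%:P) a = a - scalar_of c.
Proof.
rewrite -polyCN poly_evalD poly_evalX poly_evalC; congr (_ + _).
by apply: (addIr (scalar_of c)); rewrite -scalar_ofD !addNr scalar_of0.
Qed.

Lemma poly_evalX_exp p n a : poly_eval (p ^+ n) a = poly_eval p a ^+ n.
Proof.
elim: n => [|n IHn]; first by rewrite !expr0 -polyC1 poly_evalC scalar_of1.
by rewrite !exprS poly_evalM IHn.
Qed.

End PolyEval.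

(** * Topology in terms of the real-valued norm *)

Section RealNorm.
Context {R : realType} {V : normedModType R[i]}.
Implicit Types (x y : V).

Lemma real_norm0 : real_norm (0 : V) = 0.
Proof. by apply: (@complexI R); rewrite -real_normE normr0. Qed.

Lemma real_normN x : real_norm (- x) = real_norm x.
Proof. by rewrite /real_norm normrN. Qed.

Lemma real_norm_eq0 x : real_norm x = 0 -> x = 0.
Proof. by move=> x0; apply/normr0_eq0; rewrite real_normE x0. Qed.

Lemma real_norm_gt0 x : x <> 0 -> 0 < real_norm x.
Proof.
move=> x0; rewrite lt_neqAle real_norm_ge0 andbT eq_sym.
by apply/eqP => /real_norm_eq0.
Qed.

Lemma real_normZr (c : R) x : 0 <= c -> real_norm (c%:C *: x) = c * real_norm x.
Proof. by move=> c0; rewrite real_normZ ger0_norm ?lecR. Qed.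

Lemma near_real_norm x (A : set V) :
  nbhs x A <-> exists2 e : R, 0 < e & [set y | real_norm (y - x) < e] `<=` A.
Proof.
split=> [/nbhs_ballP[e /= e0 eA]|[e e0 eA]].
  have er := gtr0_real e0; exists (complex.Re e); first by rewrite -ltcR RRe_real.
  move=> y xy; apply: eA; rewrite -ball_normE /= distrC.
  by rewrite real_normE -(RRe_real er) ltcR.
apply/nbhs_ballP; exists e%:C; first by rewrite /= ltcR.
by move=> y; rewrite -ball_normE /= distrC real_normE ltcR => ye; apply: eA.
Qed.

Lemma real_norm_bound (S : bounded_operator V) :
  exists2 b : R, 0 < b & forall x, real_norm (S x) <= b * real_norm x.
Proof.
have [L L0 SL] := operator_bound S; have Lr := gtr0_real L0.
exists (complex.Re L) => [|x]; first by rewrite -ltcR RRe_real.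
by have := SL x; rewrite -(RRe_real Lr) !real_normE -rmorphM lecR.
Qed.

Lemma closed_ball_bounded (r : R) : bounded_set [set x : V | real_norm x <= r].
Proof.
exists r%:C; split; first by rewrite complex_real.
by move=> s rs x /= xr; rewrite (le_trans _ (ltW rs))// real_normE lecR.
Qed.

Lemma compact_operator_ball (S : bounded_operator V) (r : R) : compact_operator S ->
  compact (closure (S @` [set x | real_norm x <= r])).
Proof. by move=> cS; rewrite -precompactE; apply/cS/closed_ball_bounded. Qed.

End RealNorm.

(** * Operators that are left invertible modulo the compact operators *)

Section Proper.
Context {R : realType} {X : normedModType R[i]} (S B : bounded_operator X).
Hypothesis BS : compact_operator (B * S - 1).

(** Along the filter, [x = B (S x) - K x] with [K] compact and [B (S x)]
    convergent; a cluster point of [K x] thus yields one of [x].  Lower bounds,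
    closed range and the compactness of the unit sphere of the kernel are all
    obtained from this form of properness. *)
Lemma proper_cluster (F : set_system X) (r : R) (y : X) : ProperFilter F ->
  F [set x | real_norm x <= r] -> S x @[x --> F] --> y ->
  exists2 x, cluster F x & S x = y.
Proof.
move=> FF Fr SF; pose K : bounded_operator X := B * S - 1.
have [|z [_ Kz]] := @compact_operator_ball _ _ _ r BS (K x @[x --> F]).
  by apply: (@filterS _ F _ _ _ _ Fr) => x xr; apply: subset_closure; exists x.
have BSF : B (S x) @[x --> F] --> B y.
  by apply: continuous_cvg SF; exact: operator_continuous.
have Fx : cluster F (B y - z).
  move=> A V FA.
  have : (fun u : X * X => u.1 - u.2) @ (B y, z) --> B y - z.
    apply: (@cvgB _ _ _ (nbhs (B y, z)) _ fst snd); [exact: cvg_fst|exact: cvg_snd].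
  move=> cB /cB[[/= P Q] [Py Qz] PQ].
  have FAP : F (A `&` (B \o S) @^-1` P) by apply: filterI => //; exact: BSF.
  have [_ [[x [Ax Px] <-] Qx]] : (K @` (A `&` (B \o S) @^-1` P)) `&` Q !=set0.
    apply: Kz => //; apply: (@filterS _ F _ _ _ _ FAP) => x Ax; by exists x.
  have KE : B (S x) - K x = x by rewrite /K /= opprD addrA opprK subrr add0r.
  exists x; split => //; suff : V (B (S x) - K x) by rewrite KE.
  exact: (PQ (B (S x), K x) (conj Px Qx)).
exists (B y - z) => //; apply: (@norm_hausdorff _ X) => P Q Px Qy.
have [x [Qx Px']] := Fx _ _ (SF _ Qy) (operator_continuous Px).
by exists (S x).
Qed.

Lemma proper_limit (P : set X) (r : R) (y : X) :
  (forall x, P x -> real_norm x <= r) ->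
  (forall e : R, 0 < e -> exists2 x, P x & real_norm (S x - y) < e) ->
  exists2 x, closure P x & S x = y.
Proof.
move=> Pr Py; pose D e := P `&` [set x | real_norm (S x - y) < e].
have D_filter : Filter (filter_from [set e : R | 0 < e] D).
  apply: filter_from_filter; first by exists 1; rewrite /= ltr01.
  move=> d e /= d0 e0; exists (Num.min d e); first by rewrite lt_min d0.
  by move=> x [Px]; rewrite /= lt_min => /andP[xd xe].
have D_proper : ProperFilter (filter_from [set e : R | 0 < e] D).
  by apply: filter_from_proper => e /Py[x Px xe]; exists x.
have [||x Dx Sxy] := proper_cluster D_proper (r := r) (y := y).
- by exists 1 => [|x [/Pr]]; rewrite /= ?ltr01.
- move=> A /near_real_norm[e e0 eA]; exists e => // x [_ xe]; exact: eA.
exists x => // V Vx; have [|z [Pz Vz]] := Dx P V _ Vx; last by exists z.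
by exists 1 => [|z []]; rewrite /= ?ltr01.
Qed.

End Proper.

(** * Riesz's lemma and kernels of restrictions *)

Section Geometry.
Local Open Scope quotient_scope.
Context {R : realType} {X : normedModType R[i]}.
Implicit Types (S : bounded_operator X) (Y Z N : closed_subspace X).

(** Besides the usual unit vector [u] almost orthogonal to [Z], the lemma
    records that [u] is, up to a positive factor, a translate of [x] by an
    element of [Z]: so [u] stays in any subspace that contains [x] and [Z], and
    an operator that vanishes on [Z] takes proportional values at [x] and [u]. *)
Lemma riesz_lemma Z x : ~ Z x ->
  exists u (t : R), [/\ 0 < t, Z (t%:C *: u - x), real_norm u = 1 &
    forall z, Z z -> 1 <= 2 * real_norm (u - z)].
Proof.
move=> nZx; pose q := \pi_(linear_quotient Z) x.
have q0 : 0 < quotient_real_norm q.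
  rewrite lt_neqAle quotient_real_norm_ge0 andbT; apply/eqP => q0; apply: nZx.
  have /normr0_eq0 : `|q : normed_quotient Z| = 0 by rewrite norm_quotientE -q0.
  rewrite -[0 : normed_quotient Z](scale0r (\pi_(linear_quotient Z) 0)) -quotient_piZ scale0r.
  by move/(@quotient_eq _ _ Z); rewrite subr0.
have [x' xq xe] := quotient_real_norm_adherent q q0.
have t0 : 0 < real_norm x'.
  by rewrite (lt_le_trans q0)// -xq quotient_real_norm_le.
have tC : (real_norm x')%:C != 0 by rewrite fmorph_eq0 gt_eqF.
have ti : 0 <= (real_norm x')^-1 by rewrite invr_ge0 ltW.
exists (((real_norm x')^-1)%:C *: x'), (real_norm x'); split => //.
- rewrite fmorphV scalerA divff// scale1r; exact/(@quotient_eq _ _ Z).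
- by rewrite real_normZr// mulVf// gt_eqF.
move=> z Zz; rewrite -[z]scale1r -(mulVf tC) -scalerA -fmorphV -scalerBr real_normZr//.
rewrite mulrCA ler_pdivlMl// mulr1.
have Ztz := linear_subspaceZ (real_norm x')%:C Zz.
rewrite (le_trans (ltW xe))// mulr_natl mulr2n.
suff : quotient_real_norm q <= real_norm (x' - (real_norm x')%:C *: z) by move=> ?; exact: lerD.
rewrite -xq; have -> : \pi_(linear_quotient Z) x' =
    \pi_(linear_quotient Z) (x' - (real_norm x')%:C *: z).
  by apply/(@quotient_eq _ _ Z); rewrite opprB addrC subrK.
exact: quotient_real_norm_le.
Qed.

Lemma kernel_subspace0 S N : (N : set X) 0 /\ S 0 = 0.
Proof. by split; [exact: linear_subspace0|exact: linear0]. Qed.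

Lemma kernel_subspaceP S N k x y : N x /\ S x = 0 -> N y /\ S y = 0 ->
  N (k *: x + y) /\ S (k *: x + y) = 0.
Proof.
move=> [Nx Sx] [Ny Sy]; split; first exact: linear_subspaceP.
by rewrite operator_linear Sx Sy scaler0 addr0.
Qed.

Lemma kernel_closed S N : closed [set x | N x /\ S x = 0].
Proof.
apply: closedI; first exact: closed_subspace_closed.
apply: (@closed_comp _ _ S [set 0]); first by move=> x _; exact: operator_continuous.
exact/accessible_closed_set1/hausdorff_accessible/norm_hausdorff.
Qed.

Definition kernel_subspace S N : closed_subspace X :=
  @ClosedSubspace _ _ (LinearSubspace (kernel_subspace0 S N) (@kernel_subspaceP S N))
    (@kernel_closed S N).

End Geometry.

(** * Closed range *)

Section ClosedRange.
Context {R : realType} {X : normedModType R[i]} (S B : bounded_operator X).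
Hypothesis BS : compact_operator (B * S - 1).
Implicit Types N : closed_subspace X.

(** A lower bound for [S] on the quotient of [N] by the kernel, phrased with
    lifts.  If it failed, Riesz's lemma would give unit vectors almost
    orthogonal to the kernel with arbitrarily small images; they would cluster at a vector of
    the kernel, which they cannot approach. *)
Lemma bounded_lift N : exists2 c : R, 0 < c &
  forall x, N x -> exists x', [/\ N x', S x' = S x & real_norm x' <= c * real_norm (S x)].
Proof.
apply: contrapT => nbd.
have bad c : 0 < c -> exists2 x, N x &
    forall x', N x' -> S x' = S x -> c * real_norm (S x) < real_norm x'.
  move=> c0; apply: contrapT => nx; apply: nbd; exists c => // x Nx.
  apply: contrapT => nx'; apply: nx; exists x => // x' Nx' Sx'.
  by rewrite ltNge; apply/negP => x'c; apply: nx'; exists x'.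
pose P := [set x | [/\ N x, real_norm x <= 1 &
  forall z, kernel_subspace S N z -> 1 <= 2 * real_norm (x - z)]].
have [||x Px Sx0] := @proper_limit _ _ _ _ BS P 1 0.
- by move=> x [].
- move=> e e0; have [|x Nx xe] := bad e^-1; first by rewrite invr_gt0.
  have nZx : ~ kernel_subspace S N x.
    move=> [_ Sx]; have := xe 0 (linear_subspace0 N).
    by rewrite linear0 Sx real_norm0 mulr0 ltxx => /(_ erefl).
  have [u [t [t0 [Ntu Stu] u1 uZ]]] := riesz_lemma nZx.
  have {}Ntu : N (t%:C *: u) by rewrite -(subrK x (_ *: _)); apply: linear_subspaceD.
  have tC : t%:C != 0 by rewrite fmorph_eq0 gt_eqF.
  have Nu : N u by rewrite -[u]scale1r -(mulVf tC) -scalerA; apply: linear_subspaceZ.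
  exists u; first by split; rewrite ?u1.
  move: Stu; rewrite linearB => /eqP; rewrite subr_eq0 => /eqP Stu.
  have := xe _ Ntu Stu; rewrite -Stu linearZ !real_normZr ?(ltW t0)// u1 mulr1.
  by rewrite mulrCA gtr_pMr// ltr_pdivrMl// mulr1 subr0.
have Zx : kernel_subspace S N x.
  split => //; apply: (@closed_subspace_closed _ _ N).
  by apply: closure_subset Px => u [].
have [|u [[_ _ /(_ _ Zx) uP] ux]] := Px [set u | real_norm (u - x) < 2^-1].
  by apply/near_real_norm; exists 2^-1; rewrite ?invr_gt0.
move: uP; rewrite leNgt => /negP; apply.
by rewrite -ltr_pdivlMl// mulr1.
Qed.

(** Points of [S N] near [y] are lifted to a bounded part of [N], where
    [proper_limit] applies. *)
Lemma image_closed N : closed (S @` (N : set X)).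
Proof.
have [c c0 lift] := bounded_lift N.
move=> y Sy; pose P := [set x | N x /\ real_norm x <= c * (real_norm y + 1)].
have [||x Px Sxy] := @proper_limit _ _ _ _ BS P (c * (real_norm y + 1)) y.
- by move=> x [].
- move=> e e0; have [|_ [[x Nx <-] /= ]] := Sy [set z | real_norm (z - y) < Num.min e 1].
    by apply/near_real_norm; exists (Num.min e 1); rewrite ?lt_min ?e0 ?ltr01.
  rewrite lt_min => /andP[xe x1].
  have [x' [Nx' Sx' x'c]] := lift x Nx; exists x'; last by rewrite Sx'.
  split => //; rewrite (le_trans x'c)// ler_pM2l//.
  by rewrite -[S x](subrK y) addrC (le_trans (real_normD _ _))// lerD2l ltW.
exists x => //; apply: (@closed_subspace_closed _ _ N).
by apply: closure_subset Px => u [].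
Qed.

Lemma image_subspace0 N : (S @` (N : set X)) 0.
Proof. by exists 0; rewrite ?linear0//; apply: linear_subspace0. Qed.

Lemma image_subspaceP N k x y :
  (S @` (N : set X)) x -> (S @` (N : set X)) y -> (S @` (N : set X)) (k *: x + y).
Proof.
move=> [u Nu <-] [v Nv <-]; exists (k *: u + v); last by rewrite linearP.
exact: linear_subspaceP.
Qed.

Definition image_subspace N : closed_subspace X :=
  @ClosedSubspace _ _ (LinearSubspace (image_subspace0 N) (@image_subspaceP N)) (@image_closed N).

End ClosedRange.

(** * The Fredholm alternative on an invariant subspace *)

Section Alternative.
Context {R : realType} {X : normedModType R[i]}.
Implicit Types (S W A : bounded_operator X) (N : closed_subspace X).

(** Riesz's classical argument, stated so as to cover both monotone cases.
    Let [u k] be a unit vector of [Y k] almost orthogonal to [Z k].  Since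
    [u k - W (u k)] is in [Z k], the distance from [W (u k)] to [Z k] is that of
    [u k]; as one of [W (u j)], [W (u k)] lies in the space [Z] of the other
    index, they are at distance at least [1/2].  But [W - A] is compact, so
    some ball of radius [1/8] contains two of the vectors [(W - A) (u k)], and
    [A (u k)] has norm at most [1/8]: two of the [W (u k)] are at distance less
    than [4/8]. *)
Lemma no_gap_sequence W A (Y Z : nat -> closed_subspace X) :
  compact_operator (W - A) -> (forall x, real_norm (A x) <= 8^-1 * real_norm x) ->
  (forall k, (Z k : set X) `<=` Y k) ->
  (forall k, exists2 y, Y k y & ~ Z k y) ->
  (forall k y, Y k y -> Z k (y - W y)) ->
  (forall j k, (j < k)%N ->
     (forall y, Y k y -> Z j (W y)) \/ (forall y, Y j y -> Z k (W y))) ->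
  False.
Proof.
move=> cK A8 ZY gap WZ WYZ.
have /choice[u uP] : forall k, exists u, [/\ Y k u, real_norm u = 1 &
    forall z, Z k z -> 1 <= 2 * real_norm (u - z)].
  move=> k; have [y Yy /riesz_lemma[u [t [t0 Zu u1 uZ]]]] := gap k.
  have tC : t%:C != 0 by rewrite fmorph_eq0 gt_eqF.
  exists u; split => //; rewrite -[u]scale1r -(mulVf tC) -scalerA.
  apply: linear_subspaceZ; rewrite -(subrK y (_ *: _)).
  by apply: linear_subspaceD => //; exact: ZY.
have sep j k : (j < k)%N -> 1 <= 2 * real_norm (W (u j) - W (u k)).
  have [Yj _ uj] := uP j; have [Yk _ uk] := uP k.
  move=> /WYZ[/(_ _ Yk) Zj|/(_ _ Yj) Zk].
    have := uj _ (linear_subspaceD (WZ _ _ Yj) Zj).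
    by rewrite opprD opprB addrA addrCA subrr addr0.
  have := uk _ (linear_subspaceD (WZ _ _ Yk) Zk).
  by rewrite opprD opprB addrA addrCA subrr addr0 -real_normN opprB.
pose K : bounded_operator X := W - A.
have [|z [_ Kz]] := @compact_operator_ball _ _ _ 1 cK (K (u n) @[n --> \oo]).
  exists 0%N => // n _; apply: subset_closure; exists (u n) => //=.
  by have [_ -> _] := uP n.
have Vz : nbhs z [set x | real_norm (x - z) < 8^-1].
  by apply/near_real_norm; exists 8^-1; rewrite ?invr_gt0.
have Kn j : nbhs (K (u n) @[n --> \oo]) [set K (u n) | n in [set n | (j < n)%N]].
  by exists j.+1 => // n /= jn; exists n.
have [_ [[j _ <-] /= Kj]] := Kz _ _ (Kn 0%N) Vz.
have [_ [[k /= jk <-] Kk]] := Kz _ _ (Kn j) Vz.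
have [_ uj1 _] := uP j; have [_ uk1 _] := uP k.
have Aj := A8 (u j); rewrite uj1 mulr1 in Aj.
have Ak := A8 (u k); rewrite uk1 mulr1 -real_normN in Ak.
have := sep j k jk; rewrite leNgt => /negP; apply.
have -> : W (u j) - W (u k) = (K (u j) - z) + - (K (u k) - z) + (A (u j) + - A (u k)).
  have WKA x : W x = K x + A x by rewrite /K /= subrK.
  by rewrite opprB [_ + (z - _)]addrA subrK !WKA opprD addrACA.
have := real_normD ((K (u j) - z) + - (K (u k) - z)) (A (u j) + - A (u k)).
have := real_normD (K (u j) - z) (- (K (u k) - z)).
have := real_normD (A (u j)) (- A (u k)).
rewrite (real_normN (K (u k) - z)).
lra.
Qed.

Section Restriction.
Variables (S G A B : bounded_operator X) (N : closed_subspace X).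
Hypotheses (BS : compact_operator (B * S - 1)).
Hypotheses (GSA : compact_operator (1 - G * S - A)).
Hypothesis A8 : forall x, real_norm (A x) <= 8^-1 * real_norm x.
Hypothesis GS : G * S = S * G.
Hypotheses (SN : invariant_subspace S N) (GN : invariant_subspace G N).

Let GSx x : G (S x) = S (G x).
Proof. by rewrite -operator_mulE GS. Qed.

Let W : bounded_operator X := 1 - G * S.
Let WE x : x - W x = G (S x).
Proof. by rewrite /W /= opprB addrC subrK. Qed.
Let WE' x : W x = x - G (S x).
Proof. by []. Qed.

(** If [S] is injective but not onto on [N], the ranges [S^k N] decrease
    strictly; they are closed because [S] maps closed subspaces to closed
    ones. *)
Lemma restriction_inj_surj : (forall x, N x -> S x = 0 -> x = 0) ->
  forall y, N y -> exists2 x, N x & S x = y.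
Proof.
move=> inj y0 Ny0; apply: contrapT => y0S.
pose Y k := iter k (image_subspace BS) N.
have YS k : (Y k.+1 : set X) `<=` Y k.
  elim: k => [x /= [u Nu <-]|k IH x [u Yu <-]]; first exact: SN.
  by exists u => //; apply: IH.
have YN j k : (j <= k)%N -> (Y k : set X) `<=` Y j.
  move=> /subnKC <-; elim: (k - j)%N => [|d IH]; first by rewrite addn0.
  by rewrite addnS => x /YS /IH.
have YG k : invariant_subspace G (Y k).
  elim: k => [|k IH] //= _ [u Yu <-].
  by exists (G u); [exact: IH|rewrite GSx].
have SY k x : Y k x -> Y k.+1 (S x) by move=> Yx; exists x.
apply: (@no_gap_sequence W A Y (fun k => Y k.+1)) => //.
- move=> k; exists (iter k S y0).
    by elim: k => [|k IH] //=; exact: SY.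
  elim: k => [[x Nx xy]|k IH /= [w Yw]]; first by apply: y0S; exists x.
  have Nk : N (iter k S y0) by elim: k {IH Yw} => [|k IH] //=; exact: SN.
  move=> Sw; apply: IH; suff <- : w = iter k S y0 by [].
  have Nw : N w by apply: (YN 0%N k.+1).
  apply/eqP; rewrite -subr_eq0; apply/eqP/inj; first exact: linear_subspaceB.
  by rewrite linearB /= Sw subrr.
- by move=> k y Yy; rewrite WE; apply/YG/SY.
- move=> j k jk; left=> y Yy; apply: (YN _ _ jk); rewrite WE'.
  by apply: linear_subspaceB => //; apply/YG/YS/SY.
Qed.

(** Lifting a kernel vector again and again along [S] shows that the kernels of
    the powers of [S] on [N] increase strictly. *)
Lemma restriction_surj_inj : (forall y, N y -> exists2 x, N x & S x = y) ->
  forall x, N x -> S x = 0 -> x = 0.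
Proof.
move=> surj x0 Nx0 Sx0; apply: contrapT => x00.
have SX k x : (S ^+ k.+1) x = (S ^+ k) (S x) by rewrite exprSr.
have SXl k x : (S ^+ k.+1) x = S ((S ^+ k) x) by rewrite exprS.
have GX k x : (S ^+ k) (G x) = G ((S ^+ k) x).
  by elim: k => [|k IH]; rewrite ?expr0// !SXl IH GSx.
have SS k x : (S ^+ k) x = 0 -> (S ^+ k.+1) x = 0 by rewrite SXl => ->; rewrite linear0.
have kerSX_le k j x : (j <= k)%N -> (S ^+ j) x = 0 -> (S ^+ k) x = 0.
  move=> /subnKC <-; elim: (k - j)%N => [|d IH]; first by rewrite addn0.
  by rewrite addnS => /IH /SS.
apply: (@no_gap_sequence W A (fun k => kernel_subspace (S ^+ k.+1) N)
  (fun k => kernel_subspace (S ^+ k) N)) => //.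
- by move=> k x [Nx /SS].
- move=> k; have [y Ny yx] : exists2 y, N y & (S ^+ k) y = x0.
    elim: k => [|k [y Ny yx]]; first by exists x0; rewrite ?expr0.
    by have [x Nx xy] := surj y Ny; exists x; rewrite // SX xy.
  exists y; first by split; rewrite // SXl yx.
  by move=> [_]; rewrite yx.
- move=> k y [Ny Sy]; rewrite WE; split; first exact/GN/SN.
  by rewrite GX -SX Sy linear0.
- move=> j k jk; right=> y [Ny Sy].
  rewrite WE'; split; first by apply: linear_subspaceB => //; exact/GN/SN.
  have {}Sy := kerSX_le _ _ _ jk Sy.
  by rewrite linearB /= GX -SX SXl Sy sub0r !linear0.
Qed.

End Restriction.
End Alternative.

(** * Riesz operators and the Calkin algebra *)

Section Approximation.
Context {R : realType} {X : normedModType R[i]}.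
Implicit Types (S T Q A B : bounded_operator X).

Let has_sup_norm S : has_sup [set real_norm (S x) | x in [set x | `|x| <= 1]].
Proof.
split; first by exists (real_norm (S 0)), 0; rewrite //= normr0 ler01.
have [b b0 Sb] := real_norm_bound S; exists b => _ [x /= x1 <-].
rewrite (le_trans (Sb x))// -[leRHS]mulr1 ler_pM2l//.
by rewrite -lecR -real_normE.
Qed.

Lemma operator_norm_ge0 S : 0 <= operator_norm S.
Proof.
apply: ub_le_sup; first by case: (has_sup_norm S).
by exists 0; rewrite /= ?normr0 ?ler01// linear0 real_norm0.
Qed.

Lemma operator_norm_le S x : real_norm (S x) <= operator_norm S * real_norm x.
Proof.
have [->|/eqP x0] := eqVneq x 0; first by rewrite linear0 !real_norm0 mulr0.
have n0 := real_norm_gt0 x0.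
have ni : 0 <= (real_norm x)^-1 by rewrite invr_ge0 ltW.
rewrite -ler_pdivrMr// mulrC -real_normZr//.
apply: ub_le_sup; first by case: (has_sup_norm S).
exists (((real_norm x)^-1)%:C *: x); last by rewrite linearZ.
by rewrite /= real_normE real_normZr// mulVf ?gt_eqF.
Qed.

Lemma calkin_proj_eq S T : calkin_proj S = calkin_proj T <-> compact_operator (S - T).
Proof. exact: (@quotient_eq _ _ (compact_operators X)). Qed.

Lemma calkin_proj_surj (a : calkin X) : exists A, calkin_proj A = a.
Proof. by exists (repr a); apply: reprK. Qed.

Lemma calkin_proj_shift T l :
  calkin_proj (T - scalar_of l) = calkin_proj T - scalar_of l.
Proof.
rewrite calkin_projD; congr (_ + _).
by rewrite -scaleN1r calkin_projZ scaleN1r; congr (- _); rewrite calkin_projZ.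
Qed.

Lemma calkin_projX S n : calkin_proj (S ^+ n) = calkin_proj S ^+ n.
Proof.
by elim: n => [|n IH]; rewrite ?expr0// !exprS calkin_projM IH.
Qed.

Lemma calkin_norm_lt (a : calkin X) (r : R) : calkin_norm a < r ->
  exists2 A, calkin_proj A = a & operator_norm A < r.
Proof.
move=> ar; have h : has_inf [set operator_norm A | A in [set A | calkin_proj A = a]].
  split; last by exists 0 => _ [A _ <-]; exact: operator_norm_ge0.
  by have [A Aa] := calkin_proj_surj a; exists (operator_norm A), A.
have ra : 0 < r - calkin_norm a by rewrite subr_gt0.
have [_ [A Aa <-] Ar] := inf_adherent ra h.
by exists A => //; rewrite addrCA subrr addr0 in Ar.
Qed.

(** Quasinilpotence is used through representatives [A] of the powers of the
    class of [Q]: unlike the classes, they act on vectors. *)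
Lemma riesz_power Q (e : R) : riesz Q -> 0 < e -> exists n A,
  [/\ (0 < n)%N, calkin_proj A = calkin_proj Q ^+ n &
      forall x, real_norm (A x) <= e ^+ n * real_norm x].
Proof.
move=> rQ e0; have /= [m _ mQ] := cvgr_lt _ rQ e e0.
have {mQ} := mQ m.+1 (leqnSn m); set a := calkin_norm (calkin_proj Q ^+ m.+1) => ae.
have [A AQ Ae] : exists2 A, calkin_proj A = calkin_proj Q ^+ m.+1 & operator_norm A < e ^+ m.+1.
  apply: calkin_norm_lt; rewrite -/a ltNge; apply/negP => ea.
  move: ae; rewrite ltNge => /negP; apply.
  have e1 : e = (e ^+ m.+1) `^ m.+1%:R^-1.
    by rewrite -powR_mulrn ?ltW// -powRrM divff// powRr1// ltW.
  rewrite [leLHS]e1; apply: ge0_ler_powR => //; rewrite ?invr_ge0// nnegrE.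
    by rewrite exprn_ge0// ltW.
  by rewrite (le_trans _ ea)// exprn_ge0// ltW.
exists m.+1, A; split => // x; rewrite (le_trans (operator_norm_le _ _))//.
by rewrite ler_wpM2r ?real_norm_ge0// ltW.
Qed.

Lemma poly_eval_invariant T (p : {poly R[i]}) (N : closed_subspace X) :
  invariant_subspace T N -> invariant_subspace (poly_eval p T) N.
Proof.
move=> TN; elim/poly_ind: p => [|p c IH] x Nx.
  by rewrite -polyC0 poly_evalC scalar_of0; apply: linear_subspace0.
rewrite poly_evalD poly_evalMX poly_evalC.
apply: (@linear_subspaceD _ _ N); first exact/IH/TN.
exact: (linear_subspaceZ c Nx).
Qed.

Lemma power_bound B : exists2 b : R, 0 < b &
  forall n x, real_norm ((B ^+ n) x) <= b ^+ n * real_norm x.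
Proof.
have [b b0 Bb] := real_norm_bound B; exists b => // n x.
elim: n => [|n IH]; first by rewrite !expr0 mul1r.
rewrite exprS (le_trans (Bb _))// exprS -mulrA ler_pM2l//.
Qed.

(** [B] inverts [S] modulo the compact operators.  The factor [('X - l)^m] of
    the Riesz polynomial is cancelled by [B^m]: in the Calkin algebra
    [H^n = Q^n B^(m n)], where [H = q(T)] commutes with [S] and [Q = H S^m].
    Then [1 - (H / c)^n] is a polynomial in [T] that vanishes at [l], which
    produces the factor [G]. *)
Lemma essential_resolvent T l : polynomially_riesz T -> ~ essential_spectrum T l ->
  exists B (g : {poly R[i]}) A, let S := T - scalar_of l in let G := poly_eval g T in
   [/\ compact_operator (B * S - 1), compact_operator (1 - G * S - A),
       G * S = S * G & forall x, real_norm (A x) <= 8^-1 * real_norm x].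
Proof.
move=> [p [p0 rp]] /contrapT[b [Sb bS]].
have [B bE] := calkin_proj_surj b; subst b.
set S := T - scalar_of l.
rewrite -calkin_proj_shift -/S in Sb bS.
have [m [q /implyP/(_ p0) ql pq]] := multiplicity_XsubC p l.
pose c := q.[l]; have {}ql : c != 0 by move: ql; rewrite rootE.
have evalS : poly_eval ('X - l%:P) T = S by rewrite poly_eval_XsubC.
have HS r : poly_eval r T * S = S * poly_eval r T.
  by rewrite -evalS -!poly_evalM mulrC.
pose H := poly_eval q T.
have piQ : calkin_proj (poly_eval p T) = calkin_proj H * calkin_proj S ^+ m.
  by rewrite pq poly_evalM poly_evalX_exp evalS calkin_projM calkin_projX.
have [b b0 Bb] := power_bound B.
have [r cr] : exists r : R, `|c| = r%:C by exists (complex.Re `|c|); rewrite RRe_real ?normr_real.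
have c0 : 0 < r by rewrite -ltcR -cr normr_gt0.
(* This rate makes [A' B^(m n) / c^n] of norm at most [8^-n]. *)
have e0 : 0 < 8^-1 * r / b ^+ m by rewrite divr_gt0 ?exprn_gt0// mulr_gt0// invr_gt0.
have [n [A' [n0 A'Q A'e]]] := riesz_power rp e0.
pose A : bounded_operator X := (c ^+ n)^-1 *: (A' * B ^+ (m * n)).
have piH : calkin_proj H ^+ n = calkin_proj (A' * B ^+ (m * n)).
  have SBn k : calkin_proj S ^+ k * calkin_proj B ^+ k = 1.
    elim: k => [|k IH]; first by rewrite !expr0 mulr1.
    by rewrite exprSr exprS mulrA -[_ * _ * calkin_proj B]mulrA Sb mulr1.
  rewrite calkin_projM calkin_projX A'Q piQ exprMn_comm.
    by rewrite -exprM -mulrA SBn mulr1.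
  by apply: commrX; rewrite /GRing.comm -!calkin_projM HS.
pose w : {poly R[i]} := 1%:P + q ^+ n * (- (c ^+ n)^-1)%:P.
have /factor_theorem[g wg] : root w l.
  by rewrite /w rootE !(hornerE, horner_exp) mulrN mulfV ?subrr// expf_neq0.
exists B, g, A; split.
- by apply/calkin_proj_eq; rewrite calkin_projM bS.
- apply/calkin_proj_eq; rewrite -evalS -poly_evalM -wg /w.
  rewrite poly_evalD poly_evalC scalar_of1 poly_evalMC -scalar_ofC poly_evalX_exp -/H.
  rewrite opprD addrA subrr add0r.
  have -> : - (scalar_of (- (c ^+ n)^-1) * H ^+ n) = (c ^+ n)^-1 *: H ^+ n.
    by apply: operator_eq => x; rewrite /= scaleNr opprK.
  by rewrite calkin_projZ calkin_projX piH -calkin_projZ.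
- exact: HS.
move=> x; have -> : A x = (c ^+ n)^-1 *: A' ((B ^+ (m * n)) x) by [].
rewrite real_normZ normfV normrX cr -rmorphXn -fmorphV /=.
rewrite ler_pdivrMl ?exprn_gt0// (le_trans (A'e _))//.
rewrite (le_trans (ler_wpM2l _ (Bb (m * n)%N x)))//; first by rewrite exprn_ge0// ltW.
rewrite exprM mulrA -exprMn divfK ?expf_neq0 ?gt_eqF// [8^-1 * r]mulrC exprMn -mulrA.
rewrite ler_pM2l ?exprn_gt0// ler_wpM2r ?real_norm_ge0//.
rewrite -[n]prednK// exprS ler_piMr ?invr_ge0// exprn_ile1// ?invr_ge0//.
by rewrite invf_le1 ?ler1n.
Qed.

End Approximation.

(** * Resolvents, chains and induced operators *)

Section Chain.
Context {R : realType} {X : normedModType R[i]}.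
Implicit Types (S T U V : bounded_operator X) (M N P : closed_subspace X).

Lemma scalar_subE T l x : (T - scalar_of l) x = T x - l *: x.
Proof. by []. Qed.

Lemma shift_invariant T l N : invariant_subspace T N -> invariant_subspace (T - scalar_of l) N.
Proof.
move=> TN x Nx; rewrite scalar_subE.
by apply: linear_subspaceB; [exact: TN|exact: linear_subspaceZ].
Qed.

Lemma fredholm_alternative T l N : polynomially_riesz T -> ~ essential_spectrum T l ->
  invariant_subspace T N ->
  (forall x, N x -> (T - scalar_of l) x = 0 -> x = 0) <->
  (forall y, N y -> exists2 x, N x & (T - scalar_of l) x = y).
Proof.
move=> rT Tl TN; have [B [g [A [/= BS GSA GS A8]]]] := essential_resolvent rT Tl.
have SN := shift_invariant l TN; have GN := poly_eval_invariant g TN.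
split; first exact: restriction_inj_surj BS GSA A8 GS SN GN.
exact: restriction_surj_inj GSA A8 GS SN GN.
Qed.

(** Continuity of the inverse is [bounded_lift] on the whole space, which is the
    intersection of the empty family. *)
Lemma bijective_invertible S B : compact_operator (B * S - 1) ->
  (forall x, S x = 0 -> x = 0) -> (forall y, exists x, S x = y) -> invertible S.
Proof.
move=> BS inj /choice[v vS].
have injS x y : S x = S y -> x = y.
  by move=> xy; apply/eqP; rewrite -subr_eq0; apply/eqP/inj; rewrite linearB /= xy subrr.
have [c c0 lift] := bounded_lift BS (closed_subspace_bigcap set0).
have vb : v \in @bounded_linear_pred _ X.
  apply/asboolP; split.
    by move=> k x y; apply: injS; rewrite operator_linear !vS.
  exists c%:C => y; rewrite !real_normE -rmorphM lecR.
  have [|x' [_ /injS -> ]] := lift (v y); first by move=> ? [].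
  by rewrite vS.
exists (BoundedOperator vb); split; apply: operator_eq => x /=; first exact: vS.
by apply: injS; rewrite vS.
Qed.

Lemma invertible_essential T l : invertible (T - scalar_of l) -> ~ essential_spectrum T l.
Proof.
move=> [V [SV VS]]; apply; exists (calkin_proj V).
by rewrite -calkin_proj_shift -!calkin_projM SV VS.
Qed.

(** The intersection [M] of all members of the chain that meet the kernel
    nontrivially still does: as the chain is totally ordered, the traces of
    these members on the unit sphere of the kernel form a filter base, which
    clusters at a unit vector of [M]. *)
Lemma least_subspace_meeting_kernel S B (C : set (closed_subspace X)) :
  compact_operator (B * S - 1) -> complete_chain C -> (exists2 x, S x = 0 & x <> 0) ->
  exists M, [/\ C M, exists x, [/\ M x, S x = 0 & x <> 0] &
    forall N, C N -> (exists x, [/\ N x, S x = 0 & x <> 0]) -> (M : set X) `<=` N].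
Proof.
move=> BS hC [x0 Sx0 x00].
pose D := [set N | C N /\ exists x, [/\ N x, S x = 0 & x <> 0]].
have CD : C (closed_subspace_bigcap D) by apply: complete_chain_bigcap => // N [].
exists (closed_subspace_bigcap D); split => //; last first.
  by move=> N CN Nx x Dx; apply: Dx.
pose E N := [set x | [/\ N x, S x = 0 & real_norm x = 1]].
have filterE : Filter (filter_from D E).
  apply: filter_from_filter.
    exists (closed_subspace_bigcap set0); split; first by apply: complete_chain_bigcap.
    by exists x0; split => // ? [].
  move=> M N DM DN; have [MN|NM] := complete_chain_total hC DM.1 DN.1.
    by exists M => // x [Mx Sx x1]; split; split => //; apply: MN.
  by exists N => // x [Nx Sx x1]; split; split => //; apply: NM.
have properE : ProperFilter (filter_from D E).
  apply: filter_from_proper => N [_ [x [Nx Sx /real_norm_gt0 x1]]].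
  exists ((real_norm x)^-1%:C *: x); split; first exact: linear_subspaceZ.
    by rewrite linearZ /= Sx scaler0.
  by rewrite real_normZr ?invr_ge0 ?ltW// mulVf// gt_eqF.
have [N DN] : exists N, D N.
  exists (closed_subspace_bigcap set0); split; first by apply: complete_chain_bigcap.
  by exists x0; split => // ? [].
have [||x Ex Sx] := proper_cluster BS properE (r := 1) (y := 0).
- by exists N => // x [_ _]; rewrite /= => ->.
- move=> A /nbhs_singleton A0; exists N => // x [_ Sx _] /=; by rewrite Sx.
exists x; split => //.
  move=> M DM; apply: (@closed_subspace_closed _ _ M) => V xV.
  have [|z [Mz Vz]] := Ex M V _ xV; last by exists z.
  by exists M => // z [].
move=> xz; have [||z [/= z1 zx]] := Ex [set z | real_norm z = 1] [set z | real_norm (z - x) < 1].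
- by exists N => // z [].
- by apply/near_real_norm; exists 1.
by rewrite xz subr0 z1 ltxx in zx.
Qed.

Lemma closed_span_sub (D : set X) N : D `<=` N -> (closed_span D : set X) `<=` N.
Proof.
move=> DN x Dx; apply: (@closed_subspace_closed _ _ N).
apply: closure_subset Dx => _ [s [sD ->]].
rewrite big_seq; elim/big_rec: _ => [|p y ps Ny]; first exact: linear_subspace0.
by apply: linear_subspaceP => //; apply/DN/sD.
Qed.

Lemma subquotient_proj0 M P (x : subspace_type M) : subquotient_proj P x = 0 <-> P (val x).
Proof.
have p0 : subquotient_proj P (0 : subspace_type M) = 0.
  by have := subquotient_proj_linear P 0 (0 : subspace_type M) 0; rewrite !scale0r addr0 add0r.
rewrite -p0; split=> [/(@quotient_eq _ _ (trace_subspace M P))|Px].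
  by rewrite subr0.
by apply/(@quotient_eq _ _ (trace_subspace M P)); rewrite subr0.
Qed.

Lemma induced_operator_comp U V M P (UM : invariant_subspace U M) (UP : invariant_subspace U P)
    (VM : invariant_subspace V M) (VP : invariant_subspace V P) :
  U * V = 1 -> induced_operator UM UP * induced_operator VM VP = 1.
Proof.
move=> UV; apply: operator_eq => q; rewrite -[q]subquotient_projK operator_mulE.
rewrite !induced_operatorE; congr subquotient_proj; apply: val_inj => /=.
by rewrite -operator_mulE UV.
Qed.

Lemma induced_shift T l M P (TM : invariant_subspace T M) (TP : invariant_subspace T P) :
  induced_operator TM TP - scalar_of l =
  induced_operator (shift_invariant l TM) (shift_invariant l TP).
Proof.
apply: operator_eq => q; rewrite -[q]subquotient_projK.
have -> : (induced_operator TM TP - scalar_of l) (subquotient_proj P (repr q)) =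
  induced_operator TM TP (subquotient_proj P (repr q)) - l *: subquotient_proj P (repr q) by [].
rewrite !induced_operatorE addrC -scaleNr -subquotient_proj_linear; congr subquotient_proj.
by apply: val_inj; rewrite /= scaleNr addrC.
Qed.

End Chain.

(** * Ringrose's argument *)

Theorem theorem3p4 (R : realType) (X : completeNormedModType R[i])
    (T : bounded_operator X) (hRiesz : polynomially_riesz T)
    (C : set (closed_subspace X)) (hC : complete_chain C)
    (hT : forall M, C M -> invariant_subspace T M) :
  spectrum T =
  essential_spectrum T `|`
    [set l | exists (M : closed_subspace X) (CM : C M),
       predecessor C M <> M /\ spectrum (chain_operator hC hT CM) l].
Proof.
apply/seteqP; split=> l; last first.
  move=> lT Tinv; have Tl := invertible_essential Tinv.
  case: lT => // -[M [CM [_]]]; apply.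
  have [V [SV VS]] := Tinv.
  have VN N : C N -> invariant_subspace V N.
    have inj x : (T - scalar_of l) x = 0 -> x = 0.
      by move=> Sx; rewrite -[x]/((1 : bounded_operator X) x) -VS operator_mulE Sx linear0.
    move=> CN y Ny; have [surj _] := fredholm_alternative hRiesz Tl (hT N CN).
    have [x Nx <-] := surj (fun x _ => inj x) y Ny.
    by rewrite -operator_mulE VS.
  have PC := predecessor_mem M hC.
  rewrite /chain_operator induced_shift.
  exists (induced_operator (VN M CM) (VN _ PC)).
  by split; apply: induced_operator_comp.
move=> lT; apply: contrapT => /not_orP[Tl nM]; apply: nM.
have [B [_ [_ [/= BS _ _ _]]]] := essential_resolvent hRiesz Tl.
pose S := T - scalar_of l.
have [x0 Sx0 x00] : exists2 x, S x = 0 & x <> 0.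
  apply: contrapT => noker; apply: lT.
  have inj x : S x = 0 -> x = 0.
    by move=> Sx; apply: contrapT => x0; apply: noker; exists x.
  pose full := @closed_subspace_bigcap _ X set0.
  have [|surj _] := @fredholm_alternative _ _ T l full hRiesz Tl.
    by apply: hT; apply: complete_chain_bigcap.
  apply: (bijective_invertible BS) => // y.
  have [|x _ <-] := surj (fun x _ => inj x) y; first by move=> ? [].
  by exists x.
have [M [CM [x [Mx Sx xn0]] Mmin]] :=
  least_subspace_meeting_kernel BS hC (ex_intro2 _ _ x0 Sx0 x00).
have below N : C N -> (N : set X) `<` M -> forall y, N y -> S y = 0 -> y = 0.
  move=> CN [_ nMN] y Ny Sy; apply: contrapT => y0; apply: nMN.
  by apply: Mmin => //; exists y.
have PM : (predecessor C M : set X) `<=` M.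
  apply: closed_span_sub => x' [N [_ [NM _]]]; exact: NM.
(* If [M_- = M], the closed subspace [S M], which contains each [N = S N] below
   [M], is all of [M]; then [S] is injective on [M], against the choice of [M]. *)
have neq : predecessor C M <> M.
  move=> PE; apply: xn0.
  have [_ ] := fredholm_alternative hRiesz Tl (hT M CM); apply => // {x Mx Sx} y.
  rewrite -{1}PE => Py.
  suff [x Mx <-] : image_subspace BS M y by exists x.
  apply: closed_span_sub Py => {}y [N [CN NM] Ny].
  have [/(_ (below N CN NM)) surj _] := fredholm_alternative hRiesz Tl (hT N CN).
  by have [x Nx <-] := surj y Ny; exists x => //; case: NM => NM _; apply: NM.
exists M, CM; split => //; rewrite /spectrum /= /chain_operator induced_shift => -[V [_ VS]].
apply: xn0; apply: (below _ (predecessor_mem M hC)) => //.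
  split=> // MP; apply: neq; apply: closed_subspace_eq; exact/seteqP.
have Mx' : x \in subspace_pred M by exact: mem_set.
pose q := subquotient_proj (predecessor C M) (SubspaceType Mx').
suff /subquotient_proj0 : q = 0 by [].
rewrite -[q]/((1 : bounded_operator _) q) -VS operator_mulE induced_operatorE.
have -> : subquotient_proj (predecessor C M)
    (restriction (shift_invariant l (hT M CM)) (SubspaceType Mx')) = 0.
  by apply/subquotient_proj0; have := linear_subspace0 (predecessor C M); rewrite -Sx.
exact: linear0.
Qed.
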